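(* Let $L$ be a compactly generated multiplicative lattice in which the top element $1$ is compact and every finite product of compact elements is compact. Then the product of any two $z$-elements of $L$ is a $z$-element if and only if $L$ is a $szi$-multiplicative lattice.
   Context: A multiplicative lattice is a complete lattice $(L,\leqslant,0,1)$ endowed with an associative, commutative multiplication which distributes over arbitrary joins and has $1$ as multiplicative identity. An element $c\in L$ is compact if for any $\{x_\lambda\}_{\lambda\in\Lambda}\subseteq L$, $c\leqslant\bigvee_{\lambda\in\Lambda}x_\lambda$ implies $c\leqslant\bigvee_{i=1}^n x_{\lambda_i}$ for some $n\in\mathbb{N}^+$ and $\lambda_1,\dots,\lambda_n\in\Lambda$; $L$ is compactly generated if every element of $L$ is a join of compact elements. An element $m\neq 1$ is maximal if $m\leqslant x$ and $x<1$ imply $m=x$, for all $x\in L$; $\mathcal{M}(L)$ is the set of maximal elements. For $a\in L$ put $\mathcal{M}_a=\{m\in\mathcal{M}(L)\mid a\leqslant m\}$ and $\mathsf{m}_a=\bigwedge\mathcal{M}_a$ (the empty meet is $1$). An element $x\in L$ is a $z$-element if for all $a,b\in L$, $\mathcal{M}_a=\mathcal{M}_b$ and $b\leqslant x$ imply $a\leqslant x$. A basic $z$-element of $L$ is an element of the form $\mathsf{m}_a$ for some $a\in L$. An element $x$ is idempotent if $x^2=x$. $L$ is a $szi$-multiplicative lattice (semi-$z$-idempotent) if every basic $z$-element of $L$ is idempotent. *)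

(* Defs.v *)
From HB Require Import structures.
From mathcomp Require Import all_boot all_order.
From mathcomp Require Import boolp classical_sets.

Set Implicit Arguments.
Unset Strict Implicit.
Unset Printing Implicit Defensive.

Import Order.TTheory.

Local Open Scope classical_set_scope.
Local Open Scope order_scope.

(* The join of an arbitrary set A is [supremum \bot A] and its meet is
   [infimum \top A]: the default value is returned on the empty set, where it
   is the right one, and [supremums_neq0] and [infimums_neq0] make both genuine
   bounds on every other set. *)
HB.mixin Record TBLattice_isComplete d L of Order.TBLattice d L := {
  supremums_neq0 : forall A : set L, supremums A !=set0
}.

#[short(type="completeLatticeType")]
HB.structure Definition CompleteLattice d :=
  { L of TBLattice_isComplete d L & Order.TBLattice d L }.

Lemma infimums_neq0 d (L : completeLatticeType d) (A : set L) :
  infimums A !=set0.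
Proof.
have [m [ub_m lb_m]] := supremums_neq0 (lbound A).
exists m; split => //; move=> x Ax; apply: lb_m => y; exact.
Qed.

HB.mixin Record CompleteLattice_isMultiplicative d L
    of CompleteLattice d L := {
  lmul : L -> L -> L;
  lmulA : associative lmul;
  lmulC : commutative lmul;
  lmul1x : left_id \top lmul;
  lmul_supremum : forall (a : L) (A : set L),
    lmul a (supremum \bot A) = supremum \bot [set lmul a x | x in A]
}.

#[short(type="multLatticeType")]
HB.structure Definition MultLattice d :=
  { L of CompleteLattice_isMultiplicative d L & CompleteLattice d L }.

HB.instance Definition _ d (L : multLatticeType d) :=
  Monoid.isComLaw.Build L \top (@lmul d L)
    (@lmulA d L) (@lmulC d L) (@lmul1x d L).

Section MultLatticeDefs.
Context {d : Order.disp_t} {L : multLatticeType d}.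
Implicit Types a b c m x : L.

(* Families are nonempty: with an empty family the requirement of at least one
   index would prevent \bot from being compact. *)
Definition compact_elt c : Prop :=
  forall (I : Type) (x : I -> L), inhabited I ->
    c <= supremum \bot (range x) ->
    exists (n : nat) (i : 'I_n.+1 -> I), c <= \join_(k < n.+1) x (i k).

Definition maximal_elt m : Prop :=
  m != \top /\ forall x, m <= x -> x < \top -> m = x.

Definition maximals_above a : set L := [set m | maximal_elt m /\ a <= m].

Definition meet_maximals a : L := infimum \top (maximals_above a).

Definition z_element x : Prop :=
  forall a b, maximals_above a = maximals_above b -> b <= x -> a <= x.

Definition basic_z_element x : Prop := exists a, x = meet_maximals a.

Definition idempotent_elt x : Prop := lmul x x = x.

End MultLatticeDefs.

Definition compactly_generated d (L : multLatticeType d) : Prop :=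
  forall x : L, exists2 A : set L,
    A `<=` [set c | compact_elt c] & x = supremum \bot A.

Definition szi d (L : multLatticeType d) : Prop :=
  forall x : L, basic_z_element x -> idempotent_elt x.

(* Main.v *)
(* Write m_a for the meet of the maximal elements above a: it is a z-element
   with the same maximal elements above it as a.  If all m_a are idempotent and
   b <= xy has the same maximal elements above it as a, then
   a <= m_b = m_b m_b <= xy.
   Conversely, maximal elements are prime, so m_a and m_a m_a have the same
   maximal elements above them; if m_a m_a is a z-element, it is thus above
   m_a. *)
Require Import Defs.
From mathcomp Require Import all_boot all_order.
From mathcomp Require Import boolp classical_sets.

Import Order.TTheory.
Local Open Scope classical_set_scope.
Local Open Scope order_scope.

Section CompleteLattice.
Context {d : Order.disp_t} {L : completeLatticeType d}.
Implicit Types (A : set L) (x y : L).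

Lemma supremum_in_supremums A : supremums A (supremum \bot A).
Proof.
rewrite /supremum; case: eqP => [->|_]; first by split=> // y _; exact: le0x.
by case: xgetP => [y _ //|nex]; have [y /nex] := supremums_neq0 A.
Qed.

Lemma infimum_in_infimums A : infimums A (infimum \top A).
Proof.
rewrite /infimum; case: eqP => [->|_]; first by split=> // y _; exact: lex1.
by case: xgetP => [y _ //|nex]; have [y /nex] := infimums_neq0 A.
Qed.

Lemma le_supremum A x : A x -> x <= supremum \bot A.
Proof. by move=> Ax; apply: (supremum_in_supremums A).1. Qed.

Lemma supremum_le A y : ubound A y -> supremum \bot A <= y.
Proof. by move=> Ay; apply: (supremum_in_supremums A).2. Qed.

Lemma infimum_le A x : A x -> infimum \top A <= x.
Proof. by move=> Ax; apply: (infimum_in_infimums A).1. Qed.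

Lemma le_infimum A y : lbound A y -> y <= infimum \top A.
Proof. by move=> Ay; apply: (infimum_in_infimums A).2. Qed.

(** Carries distributivity, which is assumed for arbitrary suprema, over to binary joins. *)
Lemma supremum_set2 x y : supremum \bot [set x; y] = x `|` y.
Proof.
apply/le_anti/andP; split.
  by apply: supremum_le => z [->|->]; [exact: leUl | exact: leUr].
by rewrite leUx; apply/andP; split; apply: le_supremum; [left | right].
Qed.

End CompleteLattice.

Section MultLattice.
Context {d : Order.disp_t} {L : multLatticeType d}.
Implicit Types a b c m x y : L.

Lemma lmulUr a x y : lmul a (x `|` y) = lmul a x `|` lmul a y.
Proof. by rewrite -supremum_set2 lmul_supremum image_setU !image_set1 supremum_set2. Qed.

Lemma lmul_le a b x y : a <= x -> b <= y -> lmul a b <= lmul x y.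
Proof.
have mono c u v : u <= v -> lmul c u <= lmul c v.
  (* With [v] written as a join involving [u], distributivity makes [lmul c u] one of the two
     joinands of [lmul c v]. *)
  by move=> /join_idPl uv; rewrite -uv lmulUr leUr.
by move=> ax /mono/le_trans; apply; rewrite !(lmulC _ y); exact: mono.
Qed.

Lemma lmul_lel x y : lmul x y <= x.
Proof. by rewrite -[leRHS]lmul1x lmulC lmul_le ?lex1. Qed.

Lemma lmul_ler x y : lmul x y <= y.
Proof. by rewrite lmulC lmul_lel. Qed.

(** If [x] is not below [m], maximality forces [x] and [m] to join to [\top]; multiplying by [y]
    writes [y] as the join of [lmul x y] and [lmul m y], both below [m]. *)
Lemma maximal_elt_prime m x y :
  maximal_elt m -> lmul x y <= m -> x <= m \/ y <= m.
Proof.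
move=> [m_neq1 m_max] xym.
have coprime z : ~~ (z <= m) -> z `|` m = \top.
  move=> zm; apply/eqP; apply: contraNT zm; rewrite -ltx1 => /m_max -> //.
    exact: leUl.
  exact: leUr.
have [|/coprime xm] := boolP (x <= m); [by left | right].
have := lmul1x y; rewrite -xm lmulC lmulUr lmulC => <-.
by rewrite leUx xym lmul_ler.
Qed.

Lemma maximals_above_lmulxx x : maximals_above (lmul x x) = maximals_above x.
Proof.
apply/seteqP; split=> m [m_max xm]; split=> //.
  by case: (maximal_elt_prime _ _ _ m_max xm).
exact: le_trans (lmul_lel x x) xm.
Qed.

Lemma le_meet_maximals a : a <= meet_maximals a.
Proof. by apply: le_infimum => m []. Qed.

Lemma maximals_above_meet_maximals a :
  maximals_above (meet_maximals a) = maximals_above a.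
Proof.
apply/seteqP; split=> m [m_max am]; split=> //.
  exact: le_trans (le_meet_maximals a) am.
exact: infimum_le.
Qed.

(** A maximal element above [a] is above [meet_maximals a], hence above [c], hence above [b], as [b]
    and [c] have the same maximal elements above them. *)
Lemma meet_maximals_z_element a : z_element (meet_maximals a).
Proof.
move=> b c bc ca; apply: le_infimum => m am.
have : maximals_above c m.
  by split; [exact: am.1 | exact: le_trans ca (infimum_le _ _ am)].
by rewrite -bc => -[].
Qed.

(** Thus [meet_maximals b] is the least z-element above [b]. *)
Lemma z_element_meet_maximals_le x b :
  z_element x -> b <= x -> meet_maximals b <= x.
Proof. by move=> zx; apply: zx; exact: maximals_above_meet_maximals. Qed.

End MultLattice.

Theorem theorem3p9 (d : Order.disp_t) (L : multLatticeType d)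
    (L_compactly_generated : compactly_generated L)
    (top_compact : compact_elt (\top : L))
    (prod_compact : forall s : seq L,
        (forall c : L, c \in s -> compact_elt c) ->
        compact_elt (\big[lmul / \top]_(c <- s) c)) :
  (forall x y : L, z_element x -> z_element y -> z_element (lmul x y))
  <-> szi L.
Proof.
split=> [z_mul _ [a ->] | szi_L x y zx zy a b ab b_xy].
  have za := meet_maximals_z_element a.
  apply/le_anti; rewrite lmul_lel /=.
  (* The square is a z-element lying above itself, so it lies above its root, which has the same
     maximal elements above it. *)
  by apply: (z_mul _ _ za za _ _ (esym (maximals_above_lmulxx _))).
apply: le_trans (le_meet_maximals a) _; rewrite /meet_maximals ab.
rewrite -/(meet_maximals b) -(szi_L (meet_maximals b)); last by exists b.
(* Each factor is bounded separately: [b] lies below [lmul x y], hence below both [x] and [y], which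
   are z-elements. *)
apply: lmul_le; apply: z_element_meet_maximals_le => //.
  exact: le_trans b_xy (lmul_lel x y).
exact: le_trans b_xy (lmul_ler x y).
Qed.
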